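(* For every $n>0$, $$\int_0^{\infty} e^{-x^n}\,dx = \frac{1}{n}\,\Gamma\!\left(\frac{1}{n}\right),$$ and, as $n\to\infty$, $$\frac{1}{n}\,\Gamma\!\left(\frac{1}{n}\right)\sim 1-\frac{\gamma}{n}.$$
   Context: $\Gamma(x)=\int_0^\infty e^{-t}t^{x-1}\,dt$ for $x>0$ is the Gamma function, $\gamma$ is the Euler-Mascheroni constant, and $\sim$ denotes asymptotic equivalence (the ratio of the two sides tends to $1$). *)

(* Defs.v *)
From HB Require Import structures.
From mathcomp Require Import all_boot all_order all_algebra.
From mathcomp Require Import all_classical all_reals all_analysis.
From mathcomp Require Import lra.

Set Implicit Arguments.
Unset Strict Implicit.
Unset Printing Implicit Defensive.

Import Order.TTheory GRing.Theory Num.Theory.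
Import numFieldNormedType.Exports.

Local Open Scope classical_set_scope.
Local Open Scope ring_scope.

(* Meaningful for 0 < x only: for x <= 0 the Lebesgue integral is infinite and
   [Rintegral] returns the junk value 0. *)
Definition Gamma (R : realType) (x : R) : R :=
  \int[lebesgue_measure]_(t in `]0, +oo[) (expR (- t) * t `^ (x - 1)).

Definition euler_seq (R : realType) (m : nat) : R :=
  \sum_(1 <= k < m.+1) k%:R^-1 - ln m%:R.

Definition euler_gamma (R : realType) : R := limn (euler_seq R).

Definition asymp_equiv (R : realType) (f g : R -> R) : Prop :=
  f x / g x @[x --> +oo] --> (1 : R).

(* The [limn] defining [euler_gamma] is a genuine limit. *)
Lemma euler_seq_cvg (R : realType) : cvgn (euler_seq R).
Proof.
have lnle (y : R) : 0 < y -> ln y <= y - 1.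
  by move=> y0; have := @le_ln1Dx R (y - 1); rewrite subrKC; apply; lra.
have lnB (a b : R) : 0 < a -> 0 < b -> ln b - ln a <= (b - a) / a.
  move=> a0 b0; rewrite -ln_div ?posrE// mulrBl divff ?gt_eqF//.
  exact/lnle/divr_gt0.
have lnS (m : nat) : (m.+2%:R^-1 <= ln m.+2%:R - ln m.+1%:R :> R) /\
    (ln m.+2%:R - ln m.+1%:R <= m.+1%:R^-1 :> R).
  have p1 : 0 < m.+1%:R :> R by rewrite ltr0n.
  have p2 : 0 < m.+2%:R :> R by rewrite ltr0n.
  have e : m.+2%:R - m.+1%:R = 1 :> R by rewrite -natrB// subSnn.
  split; last by have := lnB _ _ p1 p2; rewrite e mul1r.
  by have := lnB _ _ p2 p1; rewrite -[X in X / _]opprB e mulN1r lerNr opprB.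
have stepS m : euler_seq R m.+2 =
    euler_seq R m.+1 + m.+2%:R^-1 - (ln m.+2%:R - ln m.+1%:R).
  rewrite /euler_seq big_nat_recr //= opprB addrA; congr (_ - _).
  by rewrite [RHS]addrAC subrK.
have ge0 m : 0 <= euler_seq R m.+1 - (ln m.+2%:R - ln m.+1%:R).
  elim: m => [|m IH].
    have [_] := lnS 0.
    rewrite /euler_seq big_nat1 !ln1 invr1; lra.
  have [_ h] := lnS m.+1.
  rewrite stepS [X in X - _]addrAC -[leRHS]addrA.
  by apply: addr_ge0 => //; rewrite subr_ge0.

suff: cvgn [sequence euler_seq R n.+1]_n.
  by move=> /cvg_ex[l]; rewrite cvg_shiftS => ?; apply/cvg_ex; exists l.
apply: nonincreasing_is_cvgn.
  apply/nonincreasing_seqP => m /=.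
  by have [h _] := lnS m; rewrite stepS -addrA gerDl subr_le0.
exists 0 => _ [m _ <-] /=.
have [h _] := lnS m; apply: le_trans (ge0 m) _.
by rewrite gerBl (le_trans _ h)// invr_ge0.
Qed.

(* Main.v *)
(* The substitution t = x^n turns Gamma(1/n) into n times the integral of
   exp(-x^n); everything is finite because exp(-x^n) <= C_n / (1 + x^2).  Both
   sides of the equivalence tend to 1: as n grows exp(-x^n) converges to the
   indicator of [0, 1] off x = 1, dominated by e / (1 + x^2) once n >= 2. *)
Require Import Defs.
From HB Require Import structures.
From mathcomp Require Import all_boot all_order all_algebra.
From mathcomp Require Import all_classical all_reals all_analysis.
From mathcomp Require Import measurable_realfun lra.

Set Implicit Arguments.
Unset Strict Implicit.
Unset Printing Implicit Defensive.

Import Order.TTheory GRing.Theory Num.Theory.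
Import numFieldNormedType.Exports.

Local Open Scope classical_set_scope.
Local Open Scope ring_scope.

(** * Power substitution in integrals over the open half-line *)

Lemma powR_continuous (R : realType) (a : R) :
  {in `]0, +oo[, continuous (@powR R ^~ a)}.
Proof.
move=> x x0; apply: differentiable_continuous; apply/derivable1_diffP.
exact: derivable_powR.
Qed.

Lemma powR_ltr_mono (R : realType) (p : R) : 0 < p ->
  {in `]0, +oo[ &, {homo @powR R ^~ p : x y / x < y}}.
Proof.
move=> p0 x y; rewrite !in_itv/= !andbT => x0 y0 xy.
by apply: gt0_ltr_powR => //; rewrite nnegrE ltW.
Qed.

Lemma itv0y_bigcup_cc (R : realType) (a b : R^nat) :
  (forall k, 0 < a k) -> a @ \oo --> 0 -> b @ \oo --> +oo ->
  \bigcup_k `[a k, b k]%classic = `]0, +oo[%classic :> set R.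
Proof.
move=> a0 al bl; apply/seteqP; split => x.
  move=> [k _] /=; rewrite !in_itv/= andbT => /andP[+ _].
  exact: lt_le_trans.
rewrite /= in_itv/= andbT => x0.
have [k [ak bk]] : exists k, a k <= x /\ x <= b k.
  near \oo => k; exists k; split; near: k; last by move/cvgryPge : bl; exact.
  exact: cvgr_le al _ x0.
by exists k => //=; rewrite in_itv/= ak bk.
Unshelve. all: by end_near. Qed.

Lemma cvg_powR_basey (R : realType) (p : R) : 0 < p ->
  x `^ p @[x --> +oo] --> +oo.
Proof.
move=> p0; apply/cvgryPge => A; near=> x.
(* The threshold for [x] is the [p]-th root of [|A| + 1], a positive upper bound of [A]; taking the
   root of [A] itself would fail for negative [A]. *)
have M0 : 0 < `|A| + 1 by rewrite ltr_wpDl.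
rewrite (@le_trans _ _ (`|A| + 1))//; first by rewrite ler_wpDr// ler_norm.
have <- : ((`|A| + 1) `^ p^-1) `^ p = `|A| + 1.
  by rewrite -powRrM mulVf ?gt_eqF// powRr1// ltW.
have Mx : (`|A| + 1) `^ p^-1 <= x by near: x; exact: nbhs_pinfty_ge.
by apply: ge0_ler_powR => //; rewrite ?(ltW p0) ?nnegrE ?powR_ge0//.
Unshelve. all: by end_near. Qed.

Lemma itvcc_sub0y (R : realType) (c d x : R) : 0 < c ->
  x \in `[c, d] -> x \in (`]0, +oo[ : interval R).
Proof.
by move=> c0; rewrite !in_itv/= andbT => /andP[+ _]; exact: lt_le_trans.
Qed.

Lemma measurable_fun_itvcc (R : realType) (f : R -> R) (c d : R) :
  {in `]0, +oo[, continuous f} -> 0 < c -> measurable_fun `[c, d]%classic f.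
Proof.
move=> cf c0; have mf : measurable_fun `](0 : R), +oo[%classic f.
  apply: open_continuous_measurable_fun; first exact: interval_open.
  by move=> x /[!inE]; exact: cf.
by apply: measurable_funS mf => // x /= /itvcc_sub0y; exact.
Qed.

(** Monotone convergence along an increasing union of compact intervals. The limit is taken in the
    extended reals, so an infinite integral is allowed. *)
Lemma ge0_cvg_integral_itv0y (R : realType) (f : R -> R) (c d : R^nat) :
  {in `]0, +oo[, continuous f} -> {in `]0, +oo[, forall x, 0 <= f x} ->
  (forall k, 0 < c k) -> c @ \oo --> 0 -> d @ \oo --> +oo ->
  {homo c : k m / (k <= m)%N >-> m <= k} ->
  {homo d : k m / (k <= m)%N >-> k <= m} ->
  (\int[lebesgue_measure]_(x in `[c k, d k]) (f x)%:E @[k --> \oo] -->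
   \int[lebesgue_measure]_(x in `]0%R, +oo[) (f x)%:E)%E.
Proof.
move=> cf f0 c0 c_0 d_y ndc ndd; rewrite -(itv0y_bigcup_cc c0 c_0 d_y).
apply: ge0_nondecreasing_set_cvg_integral => //=.
- move=> k m km; apply/subsetPset => x /=; rewrite !in_itv/= => /andP[cx xd].
  by rewrite (le_trans (ndc _ _ km))// (le_trans xd)// ndd.
- by move=> k; apply/measurable_EFinP; exact: measurable_fun_itvcc.
- by move=> k x /= /itvcc_sub0y xk; rewrite lee_fin f0// xk.
Qed.

(* The library substitution lemmas require the derivative to converge at the
   ends of the interval, which fails for powers at 0 or at infinity: substitute
   on compact intervals and exhaust. *)
Lemma ge0_powR_substitution (R : realType) (p : R) (G : R -> R) : 0 < p ->
  {in `]0, +oo[, continuous G} -> {in `]0, +oo[, forall x, 0 <= G x} ->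
  (\int[lebesgue_measure]_(t in `]0%R, +oo[) (G t)%:E =
   \int[lebesgue_measure]_(x in `]0%R, +oo[)
     (G (x `^ p) * (p * x `^ (p - 1)))%:E)%E.
Proof.
move=> p0 cG G0.
pose a k : R := k.+1%:R^-1; pose b k : R := k.+1%:R.
have a0 k : 0 < a k by rewrite invr_gt0 ltr0n.
have b0 k : 0 < b k by rewrite ltr0n.
have b_y : b @ \oo --> +oo.
  apply/cvgryPge => A; near=> k; rewrite (@le_trans _ _ k%:R) ?ler_nat//.
  by near: k; exact: nbhs_infty_ger.
have a_0 : a @ \oo --> 0 by exact: cvg_harmonic.
have a1 k : a k <= 1 by rewrite invf_le1 ?ltr0n// ler1n.
have ab k : a k <= b k by rewrite (le_trans (a1 k))// ler1n.
have nda k m : (k <= m)%N -> a m <= a k.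
  by move=> km; rewrite lef_pV2 ?posrE ?ltr0n// ler_nat.
have ndb k m : (k <= m)%N -> b k <= b m by move=> km; rewrite ler_nat.
have cF (x : R) : x \in `]0, +oo[ ->
    {for x, continuous (fun x : R => p * x `^ (p - 1))}.
  by move=> x0; apply: continuousM; [exact: cvg_cst|exact: powR_continuous].
have cF' (x : R) : x \in `]0, +oo[ ->
    {for x, continuous (@powR R ^~ p)^`()%classic}.
  move=> x0; rewrite /prop_for /continuous_at powR_derive1//.
  (* The formula for the derivative requires a positive base, which holds for all [z] close enough
     to [x]. *)
  apply: cvg_trans (cF x x0); apply: near_eq_cvg; near=> z.
  rewrite powR_derive1// in_itv/= andbT; near: z.
  by apply: lt_nbhsr; move: x0; rewrite in_itv/= andbT.
have cGF (x : R) : x \in `]0, +oo[ ->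
    {for x, continuous (fun x : R => G (x `^ p) * (p * x `^ (p - 1)))}.
  move=> x0; apply: continuousM; last exact: cF.
  apply: (@continuous_comp _ _ _ (@powR R ^~ p)); first exact: powR_continuous.
  by apply: cG; move: x0; rewrite !in_itv/= !andbT; exact: powR_gt0.
have GF_ge0 (x : R) : x \in `]0, +oo[ -> 0 <= G (x `^ p) * (p * x `^ (p - 1)).
  move=> x0; rewrite mulr_ge0 ?mulr_ge0 ?powR_ge0 ?(ltW p0)// G0//.
  by move: x0; rewrite !in_itv/= !andbT; exact: powR_gt0.
have apk_gt0 k : 0 < a k `^ p by rewrite powR_gt0.
(* Both integrals are limits of one sequence: the integrals of [G] over the images of [[a k, b k]]
   under the power map. These images again exhaust the half-line, and on each of them the compact
   substitution applies. *)
apply: (@cvg_unique _ (@ereal_hausdorff R)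
  (\int[lebesgue_measure]_(x in `[(a k `^ p)%R, (b k `^ p)%R])
     (G x)%:E @[k --> \oo])%E).
  apply: ge0_cvg_integral_itv0y => //.
  - by have := powR_cvg0 p0; move/cvg_at_rightP; apply.
  - exact: (cvg_comp b (@powR R ^~ p) b_y (cvg_powR_basey p0)).
  - by move=> k m km; apply: ge0_ler_powR;
      rewrite ?nnegrE ?(ltW p0) ?(ltW (a0 _)) ?nda.
  - by move=> k m km; apply: ge0_ler_powR;
      rewrite ?nnegrE ?(ltW p0) ?(ltW (b0 _)) ?ndb.
rewrite [X in X @ _](_ : _ = fun k =>
  (\int[lebesgue_measure]_(x in `[a k, b k])
     (G (x `^ p) * (p * x `^ (p - 1)))%:E)%E); last first.
  apply/funext => k.
  rewrite (@integration_by_substitution_increasing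
    _ (@powR R ^~ p) G (a k) (b k))//.
  - apply: eq_integral => x /[!inE] /(itvcc_sub0y (a0 k)) x0.
    by rewrite fctE/= powR_derive1.
  - move=> x y /(itvcc_sub0y (a0 k)) x0 /(itvcc_sub0y (a0 k)) y0.
    exact: powR_ltr_mono.
  - by move=> x /= /subset_itv_oo_cc /(itvcc_sub0y (a0 k)); exact: cF'.
  - apply/cvg_ex; eexists; apply: cvg_at_right_filter.
    by apply: cF'; rewrite in_itv/= a0.
  - apply/cvg_ex; eexists; apply: cvg_at_left_filter.
    by apply: cF'; rewrite in_itv/= b0.
  - split.
    + move=> x /= /subset_itv_oo_cc /(itvcc_sub0y (a0 k)).
      exact: derivable_powR.
    + apply: cvg_at_right_filter; apply: powR_continuous.
      by rewrite in_itv/= a0.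
    + apply: cvg_at_left_filter; apply: powR_continuous.
      by rewrite in_itv/= b0.
  - apply: continuous_in_subspaceT => x /[!inE] /(itvcc_sub0y (apk_gt0 k)).
    exact: cG.
exact: ge0_cvg_integral_itv0y.
Unshelve. all: by end_near. Qed.

(** * Integrable bounds and the Gamma formula *)

Lemma measurable_expRN_powR (R : realType) (n : R) (D : set R) :
  measurable D -> measurable_fun D (fun x : R => (expR (- (x `^ n)))%:E).
Proof.
move=> mD; apply/measurable_EFinP; apply: measurable_funTS.
by apply: measurableT_comp => //; exact: measurableT_comp.
Qed.

(** The integral is an arctangent, with finite value. Constant multiples of this function serve as
    all the dominating functions below. *)
Lemma integrable_oneDsqrV (R : realType) :
  lebesgue_measure.-integrable `[(0 : R), +oo[%classic
    (fun x : R => ((oneDsqr x)^-1)%:E).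
Proof.
have mf : measurable_fun `[(0 : R), +oo[%classic
    (fun x : R => ((oneDsqr x)^-1)%:E).
  apply/measurable_EFinP; apply: measurable_funTS.
  exact: continuous_measurable_fun (@continuous_oneDsqrV R).
apply/integrableP; split => //.
under eq_integral => x _ do rewrite gee0_abs ?lee_fin ?invr_ge0//.
by rewrite integral0y_oneDsqr ltry.
Qed.

(* Maximising [p ln y - y] over [y > 0]. *)
Lemma powR_le_expR (R : realType) (p y : R) : 0 < p -> 0 <= y ->
  y `^ p <= p `^ p * expR y.
Proof.
move=> p0; rewrite le_eqVlt => /predU1P[<-|y0].
  by rewrite powR0 ?gt_eqF// mulr_ge0 ?powR_ge0 ?expR_ge0.
rewrite /powR !gt_eqF// -expRD ler_expR.
have lnyp : ln y - ln p <= y / p - 1.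
  rewrite -ln_div ?posrE// -[in leLHS](subrKC 1 (y / p)) le_ln1Dx//.
  by have := divr_gt0 y0 p0; lra.
move: lnyp; rewrite -(ler_pM2l p0) !mulrBr mulrCA divff ?gt_eqF// !mulr1.
by lra.
Qed.

(** With [y = x^n] and [p = 2 / n], [x^2 = y^p] is at most [p^p * exp y], and [1] is at most
    [exp y]; adding the two gives the constant. It depends on [n], so this bound yields
    integrability for each fixed [n]. *)
Lemma expRN_powR_le (R : realType) (n x : R) : 0 < n -> 0 <= x ->
  expR (- (x `^ n)) <= (1 + (2 / n) `^ (2 / n)) / oneDsqr x.
Proof.
move=> n0 x0; rewrite expRN ler_pdivlMr ?oneDsqr_gt0// mulrC.
rewrite ler_pdivrMr ?expR_gt0//.
have -> : oneDsqr x = 1 + (x `^ n) `^ (2 / n).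
  by rewrite -powRrM mulrCA divff ?gt_eqF// mulr1 powR_mulrn.
have p0 : 0 < 2 / n by rewrite divr_gt0.
move: (2 / n) p0 => p p0; rewrite mulrDl mul1r lerD ?powR_le_expR ?powR_ge0//.
by rewrite -expR0 ler_expR powR_ge0.
Qed.

(** A bound uniform in [n], as dominated convergence requires. It combines [x^2 - 1 <= x^n] with
    [1 + x^2 <= exp (x^2)]; the former has a nonpositive left side when [x <= 1] and follows from
    [x^2 <= x^n] when [x > 1]. *)
Lemma expRN_powR_le_ge2 (R : realType) (n x : R) : 2 <= n -> 0 <= x ->
  expR (- (x `^ n)) <= expR 1 / oneDsqr x.
Proof.
move=> n2 x0.
have xn : x ^+ 2 - 1 <= x `^ n.
  have [x1|x1] := leP x 1.
    by rewrite (@le_trans _ _ 0) ?powR_ge0// subr_le0 expr_le1.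
  rewrite (@le_trans _ _ (x ^+ 2))//; first lra.
  by rewrite -powR_mulrn// ler_powR// ltW.
rewrite ler_pdivlMr ?oneDsqr_gt0//.
rewrite (@le_trans _ _ (expR (- x `^ n) * expR (x ^+ 2)))//.
  by rewrite ler_wpM2l ?expR_ge0// /oneDsqr expR_ge1Dx.
by rewrite -expRD ler_expR; lra.
Qed.

Lemma integrable_expRN_powR (R : realType) (n : R) : 0 < n ->
  lebesgue_measure.-integrable `[(0 : R), +oo[%classic
    (fun x : R => (expR (- (x `^ n)))%:E).
Proof.
move=> n0; set C := 1 + (2 / n) `^ (2 / n).
have := integrableZl _ C (integrable_oneDsqrV R) => /(_ (measurable_itv _)).
apply: le_integrable => //; first exact: measurable_expRN_powR.
move=> x /=; rewrite in_itv/= andbT => x0.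
rewrite lee_fin ger0_norm ?expR_ge0// (le_trans (expRN_powR_le n0 x0))//.
exact: ler_norm.
Qed.

Lemma integral_expRN_powR (R : realType) (n : R) : 0 < n ->
  (\int[lebesgue_measure]_(x in `[0%R, +oo[) (expR (- (x `^ n)))%:E)%E
  = (n^-1 * Gamma n^-1)%:E.
Proof.
move=> n0; rewrite -integral_itv_obnd_cbnd; last exact: measurable_expRN_powR.
(* [Gamma] is a real-valued integral, that is, [fine] of an extended one; finiteness is what lets
   [fine] be undone at the end. *)
have fin : (\int[lebesgue_measure]_(x in `]0%R, +oo[) (expR (- (x `^ n)))%:E
    \is a fin_num)%E.
  rewrite integral_itv_obnd_cbnd; last exact: measurable_expRN_powR.
  by apply: integrable_fin_num => //; exact: integrable_expRN_powR.
rewrite /Gamma /Rintegral.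
rewrite [in RHS](ge0_powR_substitution
  (G := fun t => expR (- t) * t `^ (n^-1 - 1)) n0); last 2 first.
- move=> x x0; apply: cvgM; last exact: powR_continuous.
  by apply: continuous_comp; [exact: continuousN|exact: continuous_expR].
- by move=> x _; rewrite mulr_ge0 ?expR_ge0 ?powR_ge0.
under [in RHS]eq_integral => x.
  rewrite inE/= in_itv/= andbT => x0.
  have -> : expR (- x `^ n) * (x `^ n) `^ (n^-1 - 1) * (n * x `^ (n - 1)) =
      n * expR (- x `^ n).
    (* The exponents [1 - n] and [n - 1] cancel, so only the factor [n] of the Jacobian survives. *)
    have E : x `^ (n * (n^-1 - 1)) * x `^ (n - 1) = 1.
      rewrite -powRD ?(gt_eqF x0) ?implybT// mulrBr divff ?gt_eqF// mulr1.
      by rewrite -[X in _ + X]opprB subrr powRr0.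
    by rewrite -powRrM -mulrA [X in _ * X]mulrCA E mulr1 mulrC.
  rewrite EFinM; over.
rewrite ge0_integralZl//; last 2 first.
- exact: measurable_expRN_powR.
- by rewrite lee_fin ltW.
by rewrite fineM//= mulKf ?gt_eqF// fineK.
Qed.

(** * The limit as the exponent tends to infinity *)

Lemma cvg_powR_pinfty0 (R : realType) (x : R) : 0 <= x < 1 ->
  x `^ n @[n --> +oo] --> 0.
Proof.
move=> /andP[]; rewrite le_eqVlt => /predU1P[<- _|x0 x1].
  (* Since [powR] sends [0^0] to [1], the base [0] gives the constant [0] only once [n] is
     positive. *)
  by apply: cvg_near_cst; near=> n; rewrite powR0// gt_eqF//.
have -> : powR x = (fun y => expR (- y)) \o (fun n => - ln x * n).
  by apply/funext => n /=; rewrite /powR gt_eqF// mulNr opprK mulrC.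
apply: (cvg_comp (fun n => - ln x * n) (fun y => expR (- y)) _ (@cvgr_expR R)).
by apply: gt0_cvgMry; [rewrite oppr_gt0 ln_lt0// x0|exact: cvg_id].
Unshelve. all: by end_near. Qed.

Lemma cvg_powR_pinftyy (R : realType) (x : R) : 1 < x ->
  x `^ n @[n --> +oo] --> +oo.
Proof.
move=> x1; have lnx : 0 < ln x by rewrite ln_gt0.
apply/cvgryPge => A; near=> n.
rewrite /powR gt_eqF ?(lt_trans _ x1)//.
rewrite (@le_trans _ _ (1 + n * ln x)) ?expR_ge1Dx//.
rewrite -lerBlDl -ler_pdivrMr//; near: n; exact: nbhs_pinfty_ge.
Unshelve. all: by end_near. Qed.

(** The point [1] is excluded because the left side is constantly [exp (-1)] there, while the
    indicator equals [1]. *)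
Lemma cvg_expRN_powR (R : realType) (x : R) : 0 <= x -> x != 1 ->
  expR (- (x `^ n)) @[n --> +oo] --> (\1_`[0, 1] x : R).
Proof.
move=> x0; rewrite neq_lt => /orP[x1|x1].
  rewrite indicE mem_set/= ?in_itv/= ?x0 ?ltW//.
  rewrite -expR0 -[X in expR X]oppr0.
  apply: continuous_cvg; first exact: continuous_expR.
  by apply: cvgN; apply: cvg_powR_pinfty0; rewrite x0.
rewrite indicE memNset/=; last by rewrite in_itv/= x0 leNgt x1.
exact: (cvg_comp (powR x) (fun y => expR (- y))
  (cvg_powR_pinftyy x1) (@cvgr_expR R)).
Qed.

Lemma cvg_Gamma_invr (R : realType) :
  n^-1 * Gamma n^-1 @[n --> +oo] --> (1 : R).
Proof.
pose F (n : R) : \bar R :=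
  (\int[lebesgue_measure]_(x in `[0%R, +oo[) (expR (- (x `^ n)))%:E)%E.
pose I : set R := `[0, 1]%classic.
have int1 : (\int[lebesgue_measure]_(x in `[(0:R)%R, +oo[) (\1_I x)%:E = 1)%E.
  rewrite integral_indic; [|exact: measurable_itv..].
  rewrite setIidl; last by move=> x; rewrite /I /= !in_itv/= andbT => /andP[].
  apply: etrans (lebesgue_measure_itv `[(0 : R)%R, 1%R]) _.
  by rewrite /= lte_fin ltr01 oppr0 adde0.
(* Truncating the exponent below at [2] changes nothing near infinity and makes the uniform bound
   valid for every term of a sequence, not just eventually. *)
suff : F (Num.max n 2) @[n --> +oo] --> 1%E.
  move=> F1; suff : (n^-1 * @Gamma R n^-1)%:E @[n --> +oo] --> (1 : R)%:E.
    exact: fine_cvg.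
  apply: cvg_trans F1; apply: near_eq_cvg; near=> n.
  have n2 : 2 <= n by near: n; exact: nbhs_pinfty_ge.
  by rewrite /F max_l// integral_expRN_powR// (lt_le_trans _ n2).
(* Dominated convergence concerns sequences, so the limit in the real variable [n] is tested along
   an arbitrary sequence [u] tending to infinity. *)
rewrite -int1; apply/cvge_pinftyP => u uy.
have [] := @dominated_convergence _ _ _ lebesgue_measure `[(0:R), +oo[%classic _
  (fun k x => (expR (- (x `^ (Num.max (u k) 2))))%:E)
  (fun x => (\1_I x)%:E)
  (fun x => ((expR 1)%:E * ((oneDsqr x)^-1)%:E)%E).
- by [].
- by move=> k; exact: measurable_expRN_powR.
- by apply/measurable_EFinP; apply: measurable_indic; exact: measurable_itv.
(* Pointwise convergence may fail only at [1], a null set. *)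
- exists [set 1]; split => //; first exact: lebesgue_measure_set1.
  move=> x /= /not_implyP[]; rewrite in_itv/= andbT => x0.
  apply: contra_notP => /eqP x1; apply: cvg_EFin; first exact: nearW.
  apply: (cvg_comp _ _ _ (cvg_expRN_powR x0 x1)).
  apply/cvgryPge => A; near=> k; rewrite le_max; apply/orP; left.
  by near: k; move/cvgryPge : uy; exact.
- by apply: integrableZl => //; exact: integrable_oneDsqrV.
- apply/aeW => x k /=; rewrite in_itv/= andbT => x0.
  rewrite lee_fin ger0_norm ?expR_ge0// expRN_powR_le_ge2//.
  by rewrite le_max lexx orbT.
by [].
Unshelve. all: by end_near. Qed.

Theorem theorem2p1 (R : realType) :
  (forall n : R, 0 < n ->
     (\int[lebesgue_measure]_(x in `[0%R, +oo[) (expR (- (x `^ n)))%:E)%E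
     = (n^-1 * Gamma n^-1)%:E) /\
  asymp_equiv (fun n : R => n^-1 * Gamma n^-1)
              (fun n : R => 1 - euler_gamma R / n).
Proof.
split; first exact: integral_expRN_powR.
(* The limit of the quotient is computed as [1 / 1]: the denominator tends to [1] because a constant
   divided by [n] tends to [0]. *)
rewrite /asymp_equiv -[X in _ --> X]divr1; apply: cvgM.
  exact: cvg_Gamma_invr.
apply: cvgV; first exact: oner_neq0.
rewrite -[X in _ --> X]subr0; apply: cvgB; first exact: cvg_cst.
rewrite -[X in _ --> X](mulr0 (euler_gamma R)); apply: cvgMl_tmp.
apply/gtr0_cvgV0; last exact: cvg_id.
exact: nbhs_pinfty_gt.
Qed.
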